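(* Let $G$ be a graph with edge ideal $I(G)$. Then the following are equivalent: $\rho(I(G))=1$; $G$ is a bipartite graph; $\rho_a(I(G))=1$.
   Context: All graphs are finite and simple, with no isolated vertices. The edge ideal $I(G)$, over a field $\mathbb{K}$, is the ideal of $\mathbb{K}[x : x\in V(G)]$ generated by $\{xy : \{x,y\}\in E(G)\}$. For an ideal $I$ in a Noetherian ring $R$, $I^{(s)}=\bigcap_{P\in\mathrm{Ass}(I)}(I^sR_P\cap R)$ is the $s$-th symbolic power. The resurgence and asymptotic resurgence are $\rho(I)=\sup\{s/t : s,t\in\mathbb{N},\ I^{(s)}\not\subset I^t\}$ and $\rho_a(I)=\sup\{s/t : s,t\in\mathbb{N},\ I^{(sr)}\not\subset I^{tr}\text{ for all } r\gg0\}$, where $\mathbb{N}$ denotes the positive integers. *)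

(* Defs.v *)
From HB Require Import structures.
(* The notations of mpoly and of mathcomp-analysis are incompatible;
   mpoly also redefines symmetric, hence its place before all_boot. *)
From mathcomp Require Import -(notations) mpoly.
From mathcomp Require Import all_boot all_order all_algebra.
From mathcomp Require Import fraction ring_quotient.
From mathcomp Require Import all_classical all_reals all_analysis.

Set Implicit Arguments.
Unset Strict Implicit.
Unset Printing Implicit Defensive.

Import Order.TTheory GRing.Theory Num.Theory.
Local Open Scope classical_set_scope.
Local Open Scope ring_scope.

(* The ideal of the subring A of T generated by S (with S `<=` A): all finite
   A-linear combinations of elements of S. *)
Definition gen_ideal (T : comNzRingType) (A S : set T) : set T :=
  [set x | exists (n : nat) (a s : 'I_n -> T),
     [/\ forall i, A (a i), forall i, S (s i) & x = \sum_(i < n) a i * s i]].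

Definition ideal_pow (T : comNzRingType) (I : set T) (s : nat) : set T :=
  gen_ideal setT
    [set x | exists f : 'I_s -> T, (forall i, I (f i)) /\ x = \prod_(i < s) f i].

Definition is_prime_ideal (T : comNzRingType) (P : set T) : Prop :=
  idealr_closed (mem P) /\ prime_idealr_closed (mem P).

(* Ass(I) = Ass(T/I): the primes that are the annihilator (I : f) of the class
   of some f. *)
Definition Ass (T : comNzRingType) (I : set T) : set (set T) :=
  [set P | is_prime_ideal P /\ exists f : T, P = [set g | I (g * f)]].

(* The localization of a domain T at the prime P, as a subring of the fraction
   field of T. *)
Definition localization (T : idomainType) (P : set T) : set {fraction T} :=
  [set x | exists a u : T, ~ P u /\ x = tofrac a / tofrac u].

(* J T_P `&` T *)
Definition loc_contraction (T : idomainType) (P J : set T) : set T :=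
  @tofrac T @^-1` gen_ideal (localization P) (@tofrac T @` J).

Definition symb_pow (T : idomainType) (I : set T) (s : nat) : set T :=
  \bigcap_(P in Ass I) loc_contraction P (ideal_pow I s).

(* The suprema are taken in the extended reals, so that they are the true
   suprema even when the sets are unbounded. *)
Definition resurgence (R : realType) (T : idomainType) (I : set T) : \bar R :=
  ereal_sup [set x | exists s t : nat,
    [/\ (0 < s)%N, (0 < t)%N, ~ (symb_pow I s `<=` ideal_pow I t)
      & x = (s%:R / t%:R)%:E]].

Definition asymptotic_resurgence (R : realType) (T : idomainType) (I : set T) :
    \bar R :=
  ereal_sup [set x | exists s t : nat,
    [/\ (0 < s)%N, (0 < t)%N,
        exists r0 : nat, forall r : nat, (r0 <= r)%N ->
          ~ (symb_pow I (s * r) `<=` ideal_pow I (t * r))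
      & x = (s%:R / t%:R)%:E]].

Definition simple_graph (V : finType) (e : rel V) : Prop :=
  symmetric e /\ irreflexive e.

Definition no_isolated_vertex (V : finType) (e : rel V) : Prop :=
  forall x, exists y, e x y.

Definition bipartite (V : finType) (e : rel V) : Prop :=
  exists A : {set V}, forall x y, e x y -> (x \in A) != (y \in A).

(* K[x : x in V], with the vertices numbered by enum_rank. *)
Definition vertex_ring (K : fieldType) (V : finType) : idomainType :=
  mpoly #|V| K.

Definition vertex_var (K : fieldType) (V : finType) (x : V) : vertex_ring K V :=
  mpolyX K (mnm1 (enum_rank x)).

Arguments vertex_var K {V} x.

Definition edge_ideal (K : fieldType) (V : finType) (e : rel V) :
    set (vertex_ring K V) :=
  gen_ideal setT
    [set m | exists x y, e x y /\ m = vertex_var K x * vertex_var K y].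

Arguments edge_ideal K {V} e.

(* Main.v *)
From mathcomp Require Import -(notations) mpoly.
Require Import Defs.
From mathcomp Require Import all_boot all_order all_algebra.
From mathcomp Require Import fraction zify ring.
From mathcomp Require Import all_classical all_reals all_analysis.

(** Write I for the edge ideal.  Both resurgences are at least 1 as soon as
    there is an edge xy: (xy)^s lies in I^s but, its degree being 2s, not in
    I^t for t > s, so that all ratios s/t < 1 are attained.  What has to be
    decided is whether ratios above 1 occur.

    Bipartite graphs: symbolic and ordinary powers agree, so they do not.  For
    a minimal vertex cover C the ideal generated by the variables of C is an
    associated prime of I (minimal_cover_Ass), hence every monomial of an
    element of I^(s) has degree at least s in the variables of C
    (symb_pow_cover).  Conversely let a monomial have degree at least s in the
    variables of every cover.  By the weighted form of the theorem of Koenig it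
    is a multiple of a product of s edges (monomial_ideal_pow).  This is an
    induction on s, in which one divides by an edge that is not contained in
    any cover of weight exactly s; such an edge exists because, in a bipartite
    graph, these covers of minimal weight are closed under the operations of a
    distributive lattice
    (edge_avoiding_tight_covers).

    Other graphs: let f be the product of the vertices of a closed walk of odd
    length 2n+1.  Every vertex cover contains at least n+1 of its entries.  For
    an associated prime P of I the variables in P form a vertex cover, and, as
    I is radical, P becomes equal to I in the localization at P
    (Ass_edge_idealP); hence f^k belongs to I^(k(n+1))
    (odd_walk_symb_pow).  But f^k has degree k(2n+1) only.  With k = 4r this
    gives I^((4n+4)r) (symbolic) not included in I^((4n+3)r) for every r > 0
    (not_bipartite_gap), and the ratio (4n+4)/(4n+3) exceeds 1.

    The algebra rests on one filtration of the polynomial ring: for a weight d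
    on the variables, the ideal wt_ge d k of the polynomials whose monomials
    all have weight at least k.  The degree and the degree in the variables of
    a cover are both instances. *)

Set Implicit Arguments.
Unset Strict Implicit.
Unset Printing Implicit Defensive.

Import Order.TTheory GRing.Theory Num.Theory.

(** * Vertex covers and odd closed walks *)

Section Covers.
Variables (V : finType) (e : rel V).
Implicit Types (C D A : {set V}) (w : V -> nat) (x y z : V).

Definition vertex_cover C : bool :=
  [forall x, forall y, e x y ==> (x \in C) || (y \in C)].

Lemma vertex_coverP C :
  reflect (forall x y, e x y -> (x \in C) || (y \in C)) (vertex_cover C).
Proof.
apply: (iffP forallP) => [h x y|h x].
  by have /forallP /(_ y) /implyP := h x.
by apply/forallP => y; apply/implyP; apply: h.
Qed.

Lemma cover_replace C D x : symmetric e -> vertex_cover C ->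
  C :\ x \subset D -> (forall z, e x z -> z \in D) -> vertex_cover D.
Proof.
move=> e_sym /vertex_coverP cC /fintype.subsetP CD xD.
apply/vertex_coverP => u v euv.
have [ux|ux] := eqVneq u x; first by rewrite (xD v) ?orbT // -ux.
have [vx|vx] := eqVneq v x; first by rewrite (xD u) // -vx e_sym.
have /orP[uC|vC] := cC _ _ euv; apply/orP; [left|right]; apply: CD.
  by rewrite !inE ux.
by rewrite !inE vx.
Qed.

Definition weight w C := \sum_(z in C) w z.

Lemma weightE w C : weight w C = \sum_z (z \in C) * w z.
Proof.
rewrite /weight big_mkcond; apply: eq_bigr => z _.
by case: ifP; rewrite ?mul1n.
Qed.

Lemma weight_subset w C D : C \subset D -> weight w C <= weight w D.
Proof.
move=> /fintype.subsetP CD; rewrite !weightE; apply: leq_sum => z _.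
by case: (boolP (z \in C)) => [/CD->|_]; rewrite /=; lia.
Qed.

Lemma weightU w C D : weight w (C :|: D) <= weight w C + weight w D.
Proof.
rewrite !weightE -big_split; apply: leq_sum => z _ /=; rewrite inE.
by case: (z \in C); case: (z \in D); lia.
Qed.

Lemma weightD1 w C x : x \in C -> weight w C = w x + weight w (C :\ x).
Proof. by move=> xC; rewrite /weight (big_setD1 x). Qed.

(** In a bipartite graph with sides A and ~: A, the meet of C and D in the
    distributive lattice of vertex covers, ordered by inclusion on A and by
    reverse inclusion on the other side.  The join is mix (~: A) C D. *)
Definition mix A C D : {set V} := ((C :&: D) :&: A) :|: ((C :|: D) :\: A).

Lemma mix_cover A C D : (forall x y, e x y -> (x \in A) != (y \in A)) ->
  vertex_cover C -> vertex_cover D -> vertex_cover (mix A C D).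
Proof.
move=> Abip /vertex_coverP cC /vertex_coverP cD; apply/vertex_coverP => x y exy.
have := Abip _ _ exy; have := cC _ _ exy; have := cD _ _ exy; rewrite !inE.
by case: (x \in A); case: (y \in A); case: (x \in C); case: (x \in D);
  case: (y \in C); case: (y \in D).
Qed.

Lemma weight_mix w A C D :
  weight w (mix A C D) + weight w (mix (~: A) C D) = weight w C + weight w D.
Proof.
rewrite !weightE -!big_split; apply: eq_bigr => z _ /=; rewrite !inE.
by case: (z \in A); case: (z \in C); case: (z \in D);
  rewrite /= ?mul0n ?mul1n ?addn0 ?add0n.
Qed.

(** The induction step of the weighted theorem of Koenig: when the weights of x
    and y are lowered by one, every cover keeps weight at least s.  Fix x on
    the side A, and among the covers of weight s+1 that contain x let Cx be the
    lattice minimum, the one with the largest part outside A.  Some neighbour y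
    of x with positive weight is outside Cx, since otherwise x could be dropped
    from Cx at no cost, giving a cover of weight at most s.  By the choice of
    Cx this y belongs to no cover of weight s+1 that contains x. *)
Lemma edge_avoiding_tight_covers A w s : symmetric e ->
    (forall x y, e x y -> (x \in A) != (y \in A)) ->
    (forall C, vertex_cover C -> s < weight w C) ->
  exists x y, [/\ e x y, 0 < w x, 0 < w y &
    forall C, vertex_cover C -> x \in C -> y \in C -> s.+1 < weight w C].
Proof.
move=> e_sym Abip ws.
(* C0 is not a cover because its weight is 0: some edge has positive ends. *)
pose C0 := [set z | w z == 0].
have wC0 : weight w C0 = 0 by apply: big1 => z; rewrite inE => /eqP.
have : ~~ vertex_cover C0 by apply/negP => /ws; rewrite wC0.
rewrite negb_forall => /existsP[x0]; rewrite negb_forall => /existsP[y0].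
rewrite negb_imply !inE negb_or -!lt0n => /and3P[exy0 wx0 wy0].
have [x [y [xA exy wx wy]]] :
    exists x y, [/\ x \in A, e x y, 0 < w x & 0 < w y].
  case: (boolP (x0 \in A)) => x0A; first by exists x0, y0.
  exists y0, x0; rewrite e_sym; split=> //.
  by have := Abip _ _ exy0; rewrite (negbTE x0A); case: (y0 \in A).
pose Q C := [&& vertex_cover C, x \in C & weight w C == s.+1].
case: (boolP [exists C, Q C]) => [/existsP[C1 QC1]|]; last first.
  rewrite negb_exists => /forallP noQ; exists x, y; split=> // C cC xC yC.
  rewrite ltn_neqAle ws // andbT; apply/eqP => wC.
  by have := noQ C; rewrite /Q cC xC wC eqxx.
have [Cx /and3P[cCx xCx /eqP wCx] maxCx] :=
  @arg_maxnP _ C1 Q (fun C => #|C :\: A|) QC1.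
have [y' [exy' wy' y'Cx]] : exists y', [/\ e x y', 0 < w y' & y' \notin Cx].
  apply: contrapT => noy.
  suff /ws : vertex_cover (Cx :\ x :|: C0).
    have := weightU w (Cx :\ x) C0; have := weightD1 w xCx.
    by rewrite wC0 wCx; lia.
  apply: (cover_replace e_sym cCx (finset.subsetUl _ _)) => z exz; rewrite !inE.
  have [zx|zx] /= := eqVneq z x.
    by have := Abip _ _ exz; rewrite zx eqxx.
  apply/orP; have [|wz] := posnP (w z); [by right; apply/eqP|left].
  by apply: contraT => zC; case: noy; exists z.
exists x, y'; split=> // C cC xC y'C.
rewrite ltn_neqAle ws // andbT; apply/eqP => wC.
(* Both the meet D and the join of Cx and C are covers, hence of weight at
   least s+1, and their weights add up to 2(s+1); so D competes with Cx. *)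
pose D := mix A Cx C.
have cD : vertex_cover D by apply: mix_cover.
have cD' : vertex_cover (mix (~: A) Cx C).
  apply: mix_cover => // u v /Abip; rewrite !inE.
  by case: (u \in A); case: (v \in A).
have wDD' := weight_mix w A Cx C.
have wD : weight w D = s.+1.
  by move: wDD' (ws _ cD) (ws _ cD'); rewrite wCx -wC -/D; clear; lia.
have /maxCx : Q D by rewrite /Q cD wD eqxx andbT /= !inE xA xCx xC.
apply/negP; rewrite -ltnNge; apply: proper_card; apply/fintype.properP; split.
  by apply/fintype.subsetP => z; rewrite !inE => /andP[-> ->]; rewrite orbT.
have y'A : y' \notin A by have := Abip _ _ exy'; rewrite xA; case: (y' \in A).
by exists y'; rewrite !inE y'A ?y'C ?orbT ?(negbTE y'Cx).
Qed.

(** Each of the size p steps of the walk has an end in C, and each entry of p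
    is an end of two consecutive steps, up to the effect of the two extremities
    of the walk.  For a closed walk these cancel, and C contains at least half
    of the entries of p. *)
Lemma walk_cover C x p : vertex_cover C -> path e x p ->
  size p + (last x p \in C) <= (x \in C) + 2 * count (mem C) p.
Proof.
move=> /vertex_coverP cC; elim: p x => [|y p IHp] x /=; first by lia.
move=> /andP[/cC exy /IHp]; move: exy.
by case: (x \in C); case: (y \in C) => //= _; lia.
Qed.

(** The bipartite double cover: its paths are the walks of the graph with a bit
    that records the parity of their length. *)
Definition double_cover : rel (V * bool) :=
  [rel u v | e u.1 v.1 && (v.2 == ~~ u.2)].

Lemma double_cover_path u p : path double_cover u p ->
  path e u.1 (map fst p) /\ (last u p).2 = u.2 (+) odd (size p).
Proof.
elim: p u => [|v p IHp] u /=; first by rewrite addbF.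
move=> /andP[/andP[euv /eqP v2] /IHp[-> ->]]; rewrite euv v2; split=> //.
by rewrite addNb addbN.
Qed.

(** When no odd closed walk exists, no vertex is connected to its twin in the
    double cover, and the vertices at even distance from the chosen root of
    their component form one side of a bipartition. *)
Lemma odd_closed_walk : symmetric e -> ~ bipartite e ->
  exists x p, [/\ path e x p, last x p = x & odd (size p)].
Proof.
move=> e_sym nbip; apply: contrapT => nowalk; apply: nbip.
have dsym : connect_sym double_cover.
  apply: sym_connect_sym => -[x b] [y c] /=; rewrite /double_cover /= e_sym.
  by congr (_ && _); case: b; case: c.
have split_levels x : ~~ connect double_cover (x, false) (x, true).
  apply/negP => /connectP[p dp lp]; apply: nowalk.
  have [ep op] := double_cover_path dp.
  exists x, (map fst p); split=> //.
    by rewrite (last_map fst p (x, false)) -lp.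
  by rewrite size_map; move: op; rewrite -lp /=.
have dstep x y b : e x y -> connect double_cover (x, b) (y, ~~ b).
  by move=> exy; apply: connect1; rewrite /double_cover /= exy eqxx.
have esymc := sym_connect_sym e_sym.
exists [set x | connect double_cover (fingraph.root e x, false) (x, false)].
move=> x y exy.
rewrite !inE; have -> : fingraph.root e y = fingraph.root e x.
  by apply/esym/eqP; rewrite (root_connect esymc) connect1.
set r := fingraph.root e x.
have lift_path p z b : path e z p ->
    connect double_cover (z, b) (last z p, b (+) odd (size p)).
  elim: p z b => [|z' p IHp] z b /=; first by rewrite addbF.
  move=> /andP[ezz' /IHp hp]; apply: connect_trans (dstep _ _ b ezz') _.
  by have := hp (~~ b); rewrite addNb addbN.
have rx : connect double_cover (r, false) (x, false)
       || connect double_cover (r, false) (x, true).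
  have /connectP[p ep ->] : connect e r x by rewrite esymc connect_root.
  by have := lift_path _ _ false ep; case: (odd _) => /= ->; rewrite ?orbT.
apply/eqP; case: (boolP (connect _ _ (x, false))) rx => /= [rx _|nrx rx] ry.
  have := connect_trans rx (dstep _ _ _ exy); rewrite /=.
  apply/negP; apply: contra (split_levels y).
  by apply: connect_trans; rewrite dsym -ry.
by have := connect_trans rx (dstep _ _ _ exy); rewrite /= -ry.
Qed.

End Covers.

Local Open Scope classical_set_scope.
Local Open Scope ring_scope.

(** * The filtration of a polynomial ring by weights *)

Lemma coef_cancel (R : idomainType) (p q : {poly R}) k : p`_0 != 0 ->
  (forall j, (j < k)%N -> (p * q)`_j = 0) -> forall j, (j < k)%N -> q`_j = 0.
Proof.
move=> p0 hpq; elim/ltn_ind=> j IH jk; have := hpq j jk.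
rewrite coefM big_ord_recl subn0 big1 ?addr0 => [/eqP|i _].
  by rewrite mulf_eq0 (negbTE p0) => /eqP.
have ij : (j - lift ord0 i < j)%N by rewrite lift0 subnSK ?leq_subr.
by rewrite (IH _ ij (ltn_trans ij jk)) mulr0.
Qed.

Section WeightFiltration.
Variables (K : fieldType) (n : nat) (d : 'I_n -> nat).
Implicit Types (p q u h : mpoly n K) (m : multinom n).

Definition mwt m : nat := (\sum_(i < n) d i * m i)%N.

Definition wt_ge (k : nat) : set (mpoly n K) :=
  [set p | forall m, mcoeff m p != 0 -> (k <= mwt m)%N].

Lemma mwtD m1 m2 : mwt (mnm_add m1 m2) = (mwt m1 + mwt m2)%N.
Proof.
rewrite /mwt -big_split /=; apply: eq_bigr => i _.
by rewrite mnmDE mulnDr.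
Qed.

Lemma wt_ge0 k : wt_ge k 0.
Proof. by move=> m; rewrite mcoeff0 eqxx. Qed.

Lemma wt_geD k p q : wt_ge k p -> wt_ge k q -> wt_ge k (p + q).
Proof.
move=> hp hq m; rewrite mcoeffD => hm.
have [p0|p0] := eqVneq (mcoeff m p) 0; last exact: hp.
by apply: hq; move: hm; rewrite p0 add0r.
Qed.

Lemma wt_geM j k p q : wt_ge j p -> wt_ge k q -> wt_ge (j + k) (p * q).
Proof.
move=> hp hq m; rewrite -mcoeff_msupp => /msuppM_le /allpairsP[[m1 m2] /=].
by rewrite !mcoeff_msupp => -[h1 h2 ->]; rewrite mwtD leq_add ?hp ?hq.
Qed.

Lemma wt_geW j k p : (j <= k)%N -> wt_ge k p -> wt_ge j p.
Proof. by move=> jk hp m /hp; apply: leq_trans. Qed.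

Lemma wt_geX m k : wt_ge k (mpolyX K m) <-> (k <= mwt m)%N.
Proof.
split=> [|km m']; first by apply; rewrite mcoeffX eqxx oner_eq0.
by rewrite mcoeffX; case: (m =P m') => [<- _|_]; rewrite ?eqxx.
Qed.

Definition grade_var (i : 'I_n) : {poly mpoly n K} :=
  'X^(d i) * (mpolyX K (mnm1 i))%:P.

(** The ring morphism that sends x_i to t^(d i) x_i: the coefficient of t^k in
    the image of p is the part of p of weight k.  It turns statements on
    weights into statements on univariate polynomials over a domain. *)
Definition grading : mpoly n K -> {poly mpoly n K} :=
  mmap (polyC \o @mpolyC n K) grade_var.

Lemma grade_mmap1 m :
  mmap1 grade_var m = 'X^(mwt m) * (mpolyX K m)%:P.
Proof.
rewrite /mmap1 /mwt.
under eq_bigr => i _ do rewrite /grade_var exprMn -exprM -polyC_exp.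
rewrite big_split /= prodrXr; congr (_ * _).
by rewrite -(rmorph_prod (@polyC _)) -mpolyXE_id.
Qed.

Lemma gradingE p k m :
  mcoeff m (grading p)`_k = if mwt m == k then mcoeff m p else 0.
Proof.
rewrite /grading /mmap coef_sum raddf_sum /= [in RHS](mpolyE p) raddf_sum /=.
rewrite (_ : (if _ then _ else _) = \sum_(m' <- msupp p)
    if mwt m == k then mcoeff m (mcoeff m' p *: mpolyX K m') else 0);
  last first.
  by case: eqP => // _; rewrite big1.
apply: eq_bigr => m' _; rewrite grade_mmap1 coefCM coefXnM coefC.
rewrite mcoeffCM mcoeffZ mcoeffX.
have [<-|mm'] := eqVneq m' m.
  case: (ltngtP k (mwt m')) => [lt|gt|->].
  - by rewrite mcoeff0 mulr0.
  - by rewrite subn_eq0 leqNgt gt mcoeff0 mulr0.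
  - by rewrite subnn eqxx mcoeffX eqxx.
rewrite mulr0 if_same; case: ltnP => _; first by rewrite mcoeff0 mulr0.
by case: eqP => _; rewrite ?mcoeff0 ?mcoeffX ?(negbTE mm') mulr0.
Qed.

Lemma gradingM p q : grading (p * q) = grading p * grading q.
Proof. exact: rmorphM. Qed.

Lemma wt_ge_grading k p :
  wt_ge k p <-> forall j, (j < k)%N -> (grading p)`_j = 0.
Proof.
split=> [hp j jk|hp m pm].
  apply/mpolyP => m; rewrite gradingE mcoeff0; case: eqP => // mj.
  by apply/eqP; apply: contraTT jk => /hp; rewrite -leqNgt mj.
rewrite leqNgt; apply/negP => /hp /(congr1 (mcoeff m)).
by rewrite gradingE eqxx mcoeff0 => /eqP; rewrite (negbTE pm).
Qed.

(** The part of weight 0 of u is nonzero, so its product with the part of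
    lowest weight of h does not vanish. *)
Lemma wt_ge_cancel k u h : ~ wt_ge 1 u -> wt_ge k (u * h) -> wt_ge k h.
Proof.
move=> hu /wt_ge_grading; rewrite gradingM => huh; apply/wt_ge_grading.
have u0 : (grading u)`_0 != 0.
  by apply/eqP => u0; apply: hu; apply/wt_ge_grading => -[].
exact: coef_cancel huh.
Qed.

End WeightFiltration.

(** * Ideal powers and symbolic powers *)

Definition glue (U : Type) n m (f : 'I_n -> U) (g : 'I_m -> U)
    (i : 'I_(n + m)) : U :=
  match fintype.split i with inl j => f j | inr j => g j end.

Lemma glue_lshift U n m (f : 'I_n -> U) (g : 'I_m -> U) i :
  glue f g (lshift m i) = f i.
Proof. by rewrite /glue (unsplitK (inl _ i)). Qed.

Lemma glue_rshift U n m (f : 'I_n -> U) (g : 'I_m -> U) i :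
  glue f g (rshift n i) = g i.
Proof. by rewrite /glue (unsplitK (inr _ i)). Qed.

Section Ideals.
Variable T : comNzRingType.
Implicit Types (I J P S : set T) (x y : T).

Definition is_ideal J : Prop :=
  [/\ J 0, forall x y, J x -> J y -> J (x + y) & forall a x, J x -> J (a * x)].

Lemma gen_ideal_is_ideal S : is_ideal (gen_ideal setT S).
Proof.
split=> [|x y|b x].
- by exists 0, (fun=> 0), (fun=> 0); split=> [//|[]//|]; rewrite big_ord0.
- move=> [n [a [s [_ hs ->]]]] [m [b [t [_ ht ->]]]].
  exists (n + m)%N, (glue a b), (glue s t); split=> // [i|].
    by rewrite /glue; case: fintype.split.
  by rewrite big_split_ord; congr (_ + _); apply: eq_bigr => i _;
    rewrite ?glue_lshift ?glue_rshift.
- move=> [n [a [s [_ hs ->]]]]; exists n, (fun i => b * a i), s; split=> //.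
  by rewrite big_distrr /=; apply: eq_bigr => i _; rewrite mulrA.
Qed.

Lemma mem_gen_ideal S x : S x -> gen_ideal setT S x.
Proof.
by move=> Sx; exists 1, (fun=> 1), (fun=> x); split; rewrite // big_ord1 mul1r.
Qed.

Lemma gen_ideal_min S J : is_ideal J -> S `<=` J -> gen_ideal setT S `<=` J.
Proof.
move=> [J0 JD JM] SJ _ [n [a [s [_ hs ->]]]].
by apply: (big_ind J) => // i _; apply/JM/SJ.
Qed.

Lemma ideal_pow_is_ideal I s : is_ideal (ideal_pow I s).
Proof. exact: gen_ideal_is_ideal. Qed.

Lemma ideal_pow0 I x : ideal_pow I 0 x.
Proof.
rewrite -[x]mulr1; have [_ _ +] := ideal_pow_is_ideal I 0; apply.
by apply: mem_gen_ideal; exists (fun=> 0); split=> [[]//|]; rewrite big_ord0.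
Qed.

Lemma ideal_pow1 I x : I x -> ideal_pow I 1 x.
Proof.
by move=> Ix; apply: mem_gen_ideal; exists (fun=> x); rewrite big_ord1.
Qed.

Lemma ideal_powM I s t x y :
  ideal_pow I s x -> ideal_pow I t y -> ideal_pow I (s + t) (x * y).
Proof.
have [I0 ID IM] := ideal_pow_is_ideal I (s + t).
move=> + Iy; move: x; apply: gen_ideal_min => [|_ [f [If ->]]].
  split=> [|x z hx hz|a x hx] /=; first by rewrite mul0r.
    by rewrite mulrDl; apply: ID.
  by rewrite -mulrA; apply: IM.
move: y Iy; apply: gen_ideal_min => [|_ [g [Ig ->]]].
  split=> [|x z hx hz|a x hx] /=; first by rewrite mulr0.
    by rewrite mulrDr; apply: ID.
  by rewrite mulrCA; apply: IM.
apply: mem_gen_ideal.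
exists (glue f g); split; first by move=> i; rewrite /glue; case: fintype.split.
by rewrite big_split_ord; congr (_ * _); apply: eq_bigr => i _;
  rewrite ?glue_lshift ?glue_rshift.
Qed.

Lemma ideal_powX I s k x : ideal_pow I s x -> ideal_pow I (s * k) (x ^+ k).
Proof.
move=> Ix; elim: k => [|k IHk]; first by rewrite muln0; apply: ideal_pow0.
by rewrite exprS mulnS; apply: ideal_powM.
Qed.

Lemma ideal_powW I s t : (s <= t)%N -> ideal_pow I t `<=` ideal_pow I s.
Proof.
move=> st; have [I0 ID IM] := ideal_pow_is_ideal I s.
apply: gen_ideal_min => // _ [f [If ->]].
rewrite -(subnKC st) in f If *; rewrite big_split_ord /= mulrC; apply: IM.
by apply: mem_gen_ideal; exists (fun i => f (lshift _ i)).
Qed.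

Lemma prime_is_ideal P : is_prime_ideal P -> is_ideal P.
Proof.
move=> [[P0 _ PD] _]; move: P0; rewrite in_setE => P0.
split=> // [x y Px Py|a x Px].
  by have := PD (1 : T) x y; rewrite !in_setE mul1r; apply.
by have := PD a x (0 : T); rewrite !in_setE addr0; apply.
Qed.

Lemma prime_not1 P : is_prime_ideal P -> ~ P 1.
Proof. by move=> [[_ /negP + _] _]; rewrite in_setE. Qed.

Lemma prime_notM P x y : is_prime_ideal P -> ~ P x -> ~ P y -> ~ P (x * y).
Proof.
move=> [_ pP] Px Py Pxy; have := pP x y; rewrite !in_setE => /(_ Pxy).
by move=> /orP[]; rewrite in_setE.
Qed.

Lemma prime_notX P x k : is_prime_ideal P -> ~ P x -> ~ P (x ^+ k).
Proof.
move=> pP Px; elim: k => [|k IHk]; first exact: prime_not1.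
by rewrite exprS; apply: prime_notM.
Qed.

End Ideals.

Section SymbolicPowers.
Variable T : idomainType.
Implicit Types (I J P : set T) (h u : T).

Lemma loc_contractionP P J h : is_prime_ideal P -> is_ideal J ->
  loc_contraction P J h <-> exists2 u, ~ P u & J (u * h).
Proof.
move=> pP [J0 JD JM]; have [P0 _ _] := prime_is_ideal pP.
have unit_notin u : ~ P u -> tofrac u != 0.
  by move=> Pu; rewrite tofrac_eq0; apply/eqP => u0; case: Pu; rewrite u0.
split=> [[n [a [s [ha hs eh]]]]|[u Pu Juh]]; last first.
  have u0 := unit_notin u Pu.
  exists 1%N, (fun=> 1 / tofrac u), (fun=> tofrac (u * h)); split.
  - by move=> _; exists 1, u; rewrite tofrac1.
  - by move=> _; exists (u * h).
  - by rewrite big_ord1 tofracM mul1r mulKf.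
(* A finite sum of fractions has a common denominator outside P. *)
pose cleared z := exists2 u, ~ P u & exists2 j, J j & tofrac u * z = tofrac j.
have : cleared (\sum_(i < n) a i * s i).
  apply: (big_ind cleared) => [|x y|i _].
  - by exists 1; [exact: prime_not1|exists 0; rewrite // tofrac0 mulr0].
  - move=> [u Pu [j Jj ej]] [v Pv [k Jk ek]].
    exists (u * v); first exact: prime_notM.
    exists (v * j + u * k); first by apply: JD; apply: JM.
    by rewrite tofracD !tofracM -ej -ek; ring.
  - have [b [u [Pu ->]]] := ha i; have [j Jj <-] := hs i.
    exists u => //; exists (b * j); first exact: JM.
    have u0 := unit_notin u Pu.
    by rewrite tofracM; field.
rewrite -eh => -[u Pu [j Jj ej]]; exists u => //.
by move: ej; rewrite -tofracM => /eqP; rewrite tofrac_eq => /eqP->.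
Qed.

(** Membership in a symbolic power without fractions: for every associated
    prime P, some multiple u h with u outside P lies in the ordinary power. *)
Lemma symb_powP I s h : symb_pow I s h <->
  forall P, Ass I P -> exists2 u, ~ P u & ideal_pow I s (u * h).
Proof.
have idl := ideal_pow_is_ideal I s.
split=> hs P aP; have [pP _] := aP.
  by apply/loc_contractionP => //; apply: hs.
by apply/loc_contractionP => //; apply: hs.
Qed.

Lemma ideal_pow_sub_symb_pow I s : ideal_pow I s `<=` symb_pow I s.
Proof.
move=> h Ih; apply/symb_powP => P [pP _]; exists 1; first exact: prime_not1.
by rewrite mul1r.
Qed.

End SymbolicPowers.

(** * Associated primes of edge ideals *)

Section WeightIdeals.
Variables (K : fieldType) (n : nat) (d : 'I_n -> nat).
Implicit Types J : set (mpoly n K).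

Lemma wt_ge_is_ideal k : is_ideal (wt_ge d k : set (mpoly n K)).
Proof.
split=> [|p q|a p hp]; [exact: wt_ge0|exact: wt_geD|].
by rewrite -[k]add0n; apply: wt_geM => // m.
Qed.

Lemma ideal_pow_wt J k s :
  J `<=` wt_ge d k -> ideal_pow J s `<=` wt_ge d (s * k).
Proof.
move=> Jk; apply: gen_ideal_min => [|_ [f [Jf ->]]].
  exact: wt_ge_is_ideal.
elim: s f Jf => [|s IHs] f Jf; first by move=> m.
by rewrite big_ord_recl mulSn; apply: wt_geM; [exact/Jk|exact: IHs].
Qed.

Lemma wt_ge1_prime : is_prime_ideal (wt_ge d 1 : set (mpoly n K)).
Proof.
have [P0 PD PM] := wt_ge_is_ideal 1.
split; first split; rewrite ?in_setE //.
- rewrite notin_setE => /(_ mnm0); rewrite mcoeff1 eqxx oner_eq0 => /(_ isT).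
  by rewrite /mwt big1 // => i _; rewrite mnm0E muln0.
- by move=> a p q; rewrite !in_setE => hp hq; apply: PD => //; apply: PM.
- move=> p q; rewrite !in_setE => hpq; apply/orP; rewrite !in_setE.
  by case: (EM (wt_ge d 1 p)) => [|/wt_ge_cancel]; [left|right; auto].
Qed.

End WeightIdeals.

Section EdgeIdeal.
Variables (K : fieldType) (V : finType) (e : rel V).
Hypotheses (e_sym : symmetric e) (e_irr : irreflexive e).

Local Notation I := (edge_ideal K e).
Local Notation var := (vertex_var K).
Implicit Types (C : {set V}) (x y : V) (m : multinom #|V|).

Definition mem_wt C (i : 'I_#|V|) : nat := enum_val i \in C.

(** The prime ideal generated by the variables of C, described by its
    monomials. *)
Definition cover_ideal C : set (vertex_ring K V) := wt_ge (mem_wt C) 1.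

Lemma mwt_mem_wt C m : mwt (mem_wt C) m = weight (fun x => m (enum_rank x)) C.
Proof.
rewrite weightE /mwt (reindex (@enum_rank V)) /=;
  last exact/onW_bij/enum_rank_bij.
by apply: eq_bigr => x _; rewrite /mem_wt enum_rankK.
Qed.

Lemma mwt_var d x : mwt d (mnm1 (enum_rank x : 'I_#|V|)) = d (enum_rank x).
Proof.
rewrite /mwt (bigD1 (enum_rank x)) //= mnm1E eqxx muln1 big1 ?addn0 // => i.
by rewrite mnm1E eq_sym => /negbTE->; rewrite muln0.
Qed.

Lemma wt_ge_var d k x :
  wt_ge d k (var x : mpoly #|V| K) <-> (k <= d (enum_rank x))%N.
Proof. by rewrite /vertex_var wt_geX mwt_var. Qed.

Lemma edge_ideal_is_ideal : is_ideal I.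
Proof. exact: gen_ideal_is_ideal. Qed.

Lemma mem_edge_ideal x y : e x y -> I (var x * var y).
Proof. by move=> exy; apply: mem_gen_ideal; exists x, y. Qed.

Lemma edge_ideal_wt d k :
  (forall x y, e x y -> k <= d (enum_rank x) + d (enum_rank y))%N ->
  I `<=` wt_ge d k.
Proof.
move=> dk; apply: gen_ideal_min => [|_ [x [y [exy ->]]]].
  exact: wt_ge_is_ideal.
by apply: wt_geW (dk _ _ exy) _; apply: wt_geM; apply/wt_ge_var.
Qed.

Lemma edge_ideal_cover C : vertex_cover e C -> I `<=` cover_ideal C.
Proof.
move=> /vertex_coverP cC; apply: edge_ideal_wt => x y /cC.
by rewrite /mem_wt !enum_rankK; case: (x \in C); case: (y \in C).
Qed.

Lemma mpolyX_var m x : (0 < m (enum_rank x))%N ->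
  mpolyX K m = var x * mpolyX K (mnm_sub m (mnm1 (enum_rank x))).
Proof.
by move=> mx; rewrite /vertex_var -mpolyXD addmC submK // lep1mP -lt0n.
Qed.

Lemma is_ideal_mpolyX (J : set (vertex_ring K V)) (p : mpoly #|V| K) :
  is_ideal J ->
  (forall m, mcoeff m p != 0 -> J (mpolyX K m)) -> J p.
Proof.
move=> [J0 JD JM] hp; rewrite [p]mpolyE.
rewrite big_seq; apply: (big_ind J) => // m.
by rewrite mcoeff_msupp -mul_mpolyC => /hp; apply: JM.
Qed.

Lemma edge_ideal_mpolyX m x y : e x y ->
  (0 < m (enum_rank x))%N -> (0 < m (enum_rank y))%N -> I (mpolyX K m).
Proof.
move=> exy mx my; have [_ _ IM] := edge_ideal_is_ideal.
have xy : enum_rank x == enum_rank y = false.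
  by apply/eqP => /enum_rank_inj xy; rewrite xy e_irr in exy.
rewrite (mpolyX_var mx) (mpolyX_var (x := y)) ?mnmBE ?mnm1E ?xy ?subn0 //.
by rewrite mulrA mulrC; apply/IM/mem_edge_ideal.
Qed.

(** The edge ideal is radical.  If a monomial m of g were divisible by no edge,
    the variables absent from m would form a cover C; then g * g, hence g,
    would lie in the prime cover_ideal C, although m does not. *)
Lemma edge_ideal_sqrt g : I (g * g) -> I g.
Proof.
move=> Igg; apply: is_ideal_mpolyX => [|m gm]; first exact: edge_ideal_is_ideal.
apply: contrapT => nIm.
pose C := [set x | m (enum_rank x) == 0%N]%SET.
have cC : vertex_cover e C.
  apply/vertex_coverP => x y exy; rewrite !inE; apply/orP.
  have [|mx] := posnP (m (enum_rank x)); first by move/eqP; left.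
  have [|my] := posnP (m (enum_rank y)); first by move/eqP; right.
  by case: nIm; apply: edge_ideal_mpolyX exy mx my.
have Cg : cover_ideal C g.
  have Cgg := edge_ideal_cover cC Igg.
  by case: (EM (cover_ideal C g)) => // /wt_ge_cancel; apply.
have := Cg _ gm; rewrite mwt_mem_wt /weight big1 // => x.
by rewrite inE => /eqP.
Qed.

(** An associated prime P = (I : g) does not contain g, because I is radical;
    so g becomes invertible in the localization at P, where P and I then
    coincide. *)
Lemma Ass_edge_idealP P : Ass I P ->
  [/\ is_prime_ideal P, I `<=` P &
    exists2 g, ~ P g & forall a, P a -> I (g * a)].
Proof.
move=> [pP [g Pg]]; have [_ _ IM] := edge_ideal_is_ideal; split=> //.
  by move=> a Ia; rewrite Pg /= mulrC; apply: IM.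
exists g => [|a]; last by rewrite Pg /= mulrC.
rewrite {1}Pg /= => /edge_ideal_sqrt Ig; apply: (prime_not1 pP).
by rewrite Pg /= mul1r.
Qed.

(** The prime of a minimal cover C is (I : f), f being the product of the
    variables outside C: by minimality each x in C has a neighbour outside C,
    so that x f is in I. *)
Lemma minimal_cover_Ass C : minset (vertex_cover e) C -> Ass I (cover_ideal C).
Proof.
move=> /minsetP[cC minC].
have pC : is_prime_ideal (cover_ideal C) by apply: wt_ge1_prime.
have [I0 ID IM] := edge_ideal_is_ideal.
split=> //; pose f := \prod_(y | y \notin C) var y; exists f.
have Cf : ~ cover_ideal C f.
  apply: (big_ind (fun f => ~ cover_ideal C f)) => [|u v|y yC].
  - exact: prime_not1.
  - exact: prime_notM.
  - by move=> /wt_ge_var; rewrite /mem_wt enum_rankK (negbTE yC).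
have Ixf x : x \in C -> I (var x * f).
  move=> xC.
  have [y exy yC] : exists2 y, e x y & y \notin C.
    apply: contrapT => noy.
    suff /minC /(_ (subD1set _ _)) /setP /(_ x) : vertex_cover e (C :\ x).
      by rewrite !inE eqxx xC.
    apply: (cover_replace e_sym cC (subxx _)) => z exz; rewrite !inE.
    apply/andP; split; first by apply: contraTneq exz => ->; rewrite e_irr.
    by apply: contraT => zC; case: noy; exists z.
  by rewrite /f (bigD1 y) //= mulrA mulrC; apply/IM/mem_edge_ideal.
apply/seteqP; split=> g /=.
  move=> Cg; apply: (@is_ideal_mpolyX [set g | I (g * f)]) => [|m /Cg].
    split=> [|a b Ia Ib|a b Ib] /=; first by rewrite mul0r.
      by rewrite mulrDl; apply: ID.
    by rewrite -mulrA; apply: IM.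
  rewrite mwt_mem_wt lt0n => Cm.
  have [x xC mx] : exists2 x, x \in C & (0 < m (enum_rank x))%N.
    apply: contrapT => nox; move: Cm; rewrite /weight big1 ?eqxx // => x xC.
    by apply/eqP; rewrite eqn0Ngt; apply/negP => mx; apply: nox; exists x.
  by rewrite /= (mpolyX_var mx) mulrAC mulrC; apply/IM/Ixf.
move=> Igf; apply: (@wt_ge_cancel _ _ _ _ f g Cf).
by rewrite mulrC; apply: edge_ideal_cover cC _ Igf.
Qed.

Lemma symb_pow_cover C s : vertex_cover e C ->
  symb_pow I s `<=` wt_ge (mem_wt C) s.
Proof.
move=> cC h /symb_powP hs; have [D minD DC] := minset_exists cC.
have [u Du Iuh] := hs _ (minimal_cover_Ass minD).
have Ch : wt_ge (mem_wt D) s h.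
  apply: wt_ge_cancel Du _; rewrite -[s]muln1.
  exact: ideal_pow_wt (edge_ideal_cover (minsetp minD)) _ Iuh.
by move=> m /Ch; rewrite !mwt_mem_wt => /leq_trans; apply; apply: weight_subset.
Qed.

End EdgeIdeal.

(** * Symbolic powers of edge ideals *)

Section SymbolicPowersOfEdgeIdeals.
Variables (K : fieldType) (V : finType) (e : rel V).
Hypotheses (e_sym : symmetric e) (e_irr : irreflexive e).

Local Notation I := (edge_ideal K e).
Local Notation var := (vertex_var K).
Implicit Types (C : {set V}) (x y : V) (m : multinom #|V|).

(** The weighted theorem of Koenig, a sum of s edges below w being read as a
    product of s generators of I that divides the monomial.  Each step of the
    induction splits off one edge. *)
Lemma monomial_ideal_pow s (w : V -> nat) : bipartite e ->
    (forall C, vertex_cover e C -> (s <= weight w C)%N) ->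
  ideal_pow I s (\prod_x var x ^+ w x).
Proof.
move=> [A Abip]; elim: s w => [|s IHs] w ws; first exact: ideal_pow0.
have [x [y [exy wx wy wxy]]] := edge_avoiding_tight_covers e_sym Abip ws.
have xy : (x == y) = false by apply/eqP => xy; rewrite xy e_irr in exy.
pose w' z := (w z - (z == x) - (z == y))%N.
have ww' z : w z = (w' z + (z == x) + (z == y))%N.
  rewrite /w'; have [->|zx] := eqVneq z x; first by rewrite xy; lia.
  by have [->|zy] := eqVneq z y; lia.
have delta u : \prod_z var z ^+ (z == u) = var u.
  rewrite (bigD1 u) //= eqxx expr1 big1 ?mulr1 // => z /negbTE->.
  exact: expr0.
have -> : \prod_z var z ^+ w z = (var x * var y) * \prod_z var z ^+ w' z.
  under eq_bigr => z _ do rewrite ww' !exprD.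
  by rewrite !big_split /= !delta -mulrA mulrC.
rewrite -add1n; apply: ideal_powM; first exact/ideal_pow1/mem_edge_ideal.
apply: IHs => C cC.
have wC : weight w C = (weight w' C + (x \in C) + (y \in C))%N.
  have count u : (u \in C) = (\sum_(z in C) (z == u))%N :> nat.
    have [uC|uC] := boolP (u \in C).
      by rewrite (bigD1 u) //= eqxx big1 // => z /andP[_ /negbTE->].
    by rewrite big1 // => z zC; case: eqP => // zu; rewrite -zu zC in uC.
  rewrite /weight !count -!big_split /=.
  by apply: eq_bigr => z _; rewrite ww'.
have := ws _ cC; have := wxy _ cC; rewrite wC.
by case: (x \in C); case: (y \in C) => /= h1 h2; try have := h1 isT isT; lia.
Qed.

Lemma symb_pow_bipartite s : bipartite e -> symb_pow I s = ideal_pow I s.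
Proof.
move=> bip; apply/seteqP; split=> [h hs|]; last exact: ideal_pow_sub_symb_pow.
apply: is_ideal_mpolyX => [|m hm]; first exact: ideal_pow_is_ideal.
have -> : mpolyX K m = \prod_x var x ^+ m (enum_rank x) :> mpoly #|V| K.
  rewrite mpolyXE_id (reindex (@enum_rank V)) //; exact/onW_bij/enum_rank_bij.
apply: monomial_ideal_pow => // C cC.
by have := symb_pow_cover e_sym e_irr cC hs hm; rewrite mwt_mem_wt.
Qed.

Lemma ideal_pow_deg s : ideal_pow I s `<=` wt_ge (fun=> 1%N) (s * 2).
Proof. by apply: ideal_pow_wt; apply: edge_ideal_wt. Qed.

Lemma ideal_pow_subset s t : (exists x y, e x y) ->
  ideal_pow I s `<=` ideal_pow I t -> (t <= s)%N.
Proof.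
move=> [x [y exy]] st.
have Ist := ideal_powX s (ideal_pow1 (mem_edge_ideal K exy)).
rewrite mul1n in Ist; have := ideal_pow_deg (st _ Ist).
rewrite /vertex_var -mpolyXD mpolyXn => /wt_geX.
rewrite (_ : mwt _ _ = (s * 2)%N) ?leq_pmul2r //.
elim: s {st Ist} => [|s IHs].
  by rewrite /mwt big1 // => i _; rewrite mulm0n mnm0E.
by rewrite mulmS !mwtD IHs !mwt_var.
Qed.

(** If g witnesses that P is associated, multiplying by g moves each variable
    in P into I; a cover meets the walk at least n+1 times, so g^c f lies in
    I^(n+1) for c the number of entries of the walk in P. *)
Lemma odd_walk_symb_pow x p n k : path e x p -> last x p = x ->
  size p = n.*2.+1 ->
  symb_pow I (n.+1 * k) ((\prod_(z <- p) var z) ^+ k).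
Proof.
move=> ep lp sp; apply/symb_powP => P /(Ass_edge_idealP e_irr).
move=> [pP IP [g Pg gP]].
pose C := [set z | `[< P (var z) >]]%SET.
have cC : vertex_cover e C.
  apply/vertex_coverP => u v euv; rewrite !inE; apply/orP.
  have Puv : P (var u * var v) by apply/IP/mem_edge_ideal.
  case: (EM (P (var u))) => Pu; first by left; apply/asboolP.
  right; apply/asboolP; apply: contrapT => Pv.
  exact: prime_notM pP Pu Pv Puv.
have nC : (n.+1 <= count (mem C) p)%N.
  by have := walk_cover cC ep; rewrite lp sp; lia.
have gI : ideal_pow I (count (mem C) p)
    (g ^+ count (mem C) p * \prod_(z <- p) var z).
  elim: p {ep lp sp nC} => [|z p IHp]; first exact: ideal_pow0.
  rewrite big_cons /= inE; case: asboolP => Pz.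
    rewrite exprD expr1 mulrACA; apply: ideal_powM IHp.
    exact/ideal_pow1/gP.
  have [_ _ IM] := ideal_pow_is_ideal I (count (mem C) p).
  by rewrite add0n mulrCA; apply: IM.
exists (g ^+ (count (mem C) p * k)); first exact: prime_notX.
by rewrite exprM -exprMn; apply/ideal_powX/(ideal_powW nC).
Qed.

(** The factor 4 makes the degree 4r(2n+1) of f^(4r) smaller than the least
    degree 2r(4n+3) in I^((4n+3)r), while the ratio of the exponents stays
    above 1. *)
Lemma not_bipartite_gap : ~ bipartite e -> exists n, forall r, (0 < r)%N ->
  ~ (symb_pow I (n.+1 * 4 * r) `<=` ideal_pow I ((n * 4 + 3) * r)).
Proof.
move=> /(odd_closed_walk e_sym)[x [p [ep lp op]]].
have sp : size p = (size p)./2.*2.+1 by rewrite -[LHS]odd_double_half op.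
exists (size p)./2 => r r0 sub.
have := odd_walk_symb_pow (4 * r) ep lp sp; rewrite mulnA => /(sub _) h.
move: (ideal_pow_deg h).
have -> : \prod_(z <- p) var z =
    mpolyX K (\big[@mnm_add _/mnm0]_(z <- p) mnm1 (enum_rank z)).
  elim: (p) => [|z q IHq]; first by rewrite !big_nil mpolyX0.
  by rewrite !big_cons IHq mpolyXD.
rewrite mpolyXn => /wt_geX.
rewrite (_ : mwt _ _ = (4 * r * size p)%N).
  by move: sp; move: (_./2) => k ->; rewrite -muln2; nia.
elim: (4 * r)%N => [|k IHk].
  by rewrite /mwt big1 // => i _; rewrite mulm0n mnm0E.
rewrite mulmS mwtD {}IHk mulSn; congr (_ + _)%N.
elim: p {ep lp op sp sub h} => [|z p IHp].
  by rewrite big_nil /mwt big1 // => i _; rewrite mnm0E.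
by rewrite big_cons mwtD IHp mwt_var.
Qed.

End SymbolicPowersOfEdgeIdeals.

(** * Suprema of ratios *)

Section Suprema.
Variable R : realType.

Lemma ereal_sup_ratios (S : set (\bar R)) :
    (forall s t, (0 < s)%N -> (s < t)%N -> S (s%:R / t%:R)%:E) ->
    (forall x, S x -> (x <= 1)%E) ->
  ereal_sup S = 1%E.
Proof.
move=> Sst S1; apply/eqP; rewrite eq_le; apply/andP; split.
  exact/ereal_supP.
apply/lee_addgt0Pr => /= eps eps0.
have [s s0 hs] : exists2 s : nat, (0 < s)%N & (s.+1%:R^-1 <= eps :> R).
  exists (Num.truncn eps^-1).+1 => //.
  rewrite -[leRHS]invrK lef_pV2 ?posrE ?invr_gt0 //.
  apply: ltW; apply: lt_trans (truncnS_gt _) _.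
  by rewrite ltr_nat.
have : ((s%:R / s.+1%:R)%:E <= ereal_sup S)%E.
  by apply: ereal_sup_ubound; apply: Sst.
move=> /(leeD2r eps%:E); apply: le_trans.
rewrite -EFinD lee_fin.
have -> : s%:R / s.+1%:R = 1 - s.+1%:R^-1 :> R.
  have s1 : s%:R + 1 != 0 :> R by rewrite natr1 pnatr_eq0.
  by rewrite -natr1; field.
by rewrite -addrA lerDl addrC subr_ge0.
Qed.

Lemma ereal_sup_ratio_neq1 (S : set (\bar R)) s t : (0 < t < s)%N ->
  S (s%:R / t%:R)%:E -> ereal_sup S <> 1%E.
Proof.
move=> /andP[t0 ts] /ereal_sup_ubound + S1; rewrite S1 lee_fin.
by rewrite ler_pdivrMr ?ltr0n // mul1r ler_nat leqNgt ts.
Qed.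

Lemma ratio_le1 s t :
  (0 < t)%N -> (s <= t)%N -> ((s%:R / t%:R)%:E <= 1 :> \bar R)%E.
Proof.
by move=> t0 st; rewrite lee_fin ler_pdivrMr ?ltr0n // mul1r ler_nat.
Qed.

End Suprema.

(** * Resurgence and bipartite graphs *)

Theorem theorem5p3 (R : realType) (K : fieldType) (V : finType) (e : rel V)
    (simple_e : simple_graph e) (V_nonempty : (0 < #|V|)%N)
    (not_isolated : no_isolated_vertex e) :
  (resurgence R (edge_ideal K e) = 1%E <-> bipartite e) /\
  (bipartite e <-> asymptotic_resurgence R (edge_ideal K e) = 1%E).
Proof.
have [e_sym e_irr] := simple_e.
have edge : exists x y, e x y.
  by have /card_gt0P[x _] := V_nonempty; exists x; apply: not_isolated.
have gap : ~ bipartite e -> exists n, forall r, (0 < r)%N ->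
    ~ (symb_pow (edge_ideal K e) (n.+1 * 4 * r) `<=`
       ideal_pow (edge_ideal K e) ((n * 4 + 3) * r)).
  exact: not_bipartite_gap.
(split; split) => [sup1|bip|bip|sup1].
- apply: contrapT => /gap[n ngap].
  apply: (@ereal_sup_ratio_neq1 _ _ (n.+1 * 4) (n * 4 + 3)) sup1; first by lia.
  exists (n.+1 * 4)%N, (n * 4 + 3)%N; split; [lia|lia| |by []].
  by have := ngap 1%N isT; rewrite !muln1.
- apply: ereal_sup_ratios => [s t s0 st|_ [s [t [s0 t0 nst ->]]]].
    exists s, t; split=> //; first exact: leq_trans st.
    rewrite symb_pow_bipartite // => /(ideal_pow_subset edge).
    by rewrite leqNgt st.
  apply: ratio_le1 => //; rewrite leqNgt; apply/negP => ts; apply: nst.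
  by rewrite symb_pow_bipartite //; apply/ideal_powW/ltnW.
- apply: ereal_sup_ratios => [s t s0 st|_ [s [t [s0 t0 [r0 nst] ->]]]].
    exists s, t; split=> //; first exact: leq_trans st.
    exists 1%N => r r0.
    rewrite symb_pow_bipartite // => /(ideal_pow_subset edge).
    by rewrite leq_pmul2r // leqNgt st.
  apply: ratio_le1 => //; rewrite leqNgt; apply/negP => ts.
  apply: (nst r0) => //.
  rewrite symb_pow_bipartite //; apply/ideal_powW.
  by rewrite leq_mul2r ltnW ?orbT.
- apply: contrapT => /gap[n ngap].
  apply: (@ereal_sup_ratio_neq1 _ _ (n.+1 * 4) (n * 4 + 3)) sup1; first by lia.
  by exists (n.+1 * 4)%N, (n * 4 + 3)%N; split; [lia|lia|exists 1%N|].
Qed.
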